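(* Let $A$ and $B$ be Leibniz algebras over a field $\mathbb{F}$ with $A$ abelian, and let $(\varphi,\varphi',f)$ be a factor system of $A$ by $B$. Then $(\varphi,\varphi',f)$ is central if and only if $\varphi=0$ and $\varphi'=0$.
   Context: All algebras are vector spaces over a fixed field $\mathbb{F}$ with a bilinear multiplication (juxtaposition). A Leibniz algebra is an algebra satisfying $x(yz)=(xy)z+y(xz)$ for all $x,y,z$; it is abelian if its multiplication is zero. The center of $L$ is $Z(L)=\{z\in L: zx=xz=0 \text{ for all } x\in L\}$. $\mathcal{L}(A)$ is the space of linear maps $A\to A$, $\mathrm{Der}(A)\subseteq\mathcal{L}(A)$ the space of derivations ($D(mn)=D(m)n+mD(n)$), and $\mathrm{ad}^l_m n=mn$, $\mathrm{ad}^r_m n=nm$. A factor system of $A$ by $B$ is a tuple $(\varphi,\varphi',f)$ with $\varphi:B\to\mathrm{Der}(A)$ linear, $\varphi':B\to\mathcal{L}(A)$ linear, $f:B\times B\to A$ bilinear, such that for all $m,n\in A$, $i,j,k\in B$: (1) $m(\varphi(i)n)=(\varphi'(i)m)n+\varphi(i)(mn)$; (2) $m(\varphi'(i)n)=\varphi'(i)(mn)+n(\varphi'(i)m)$; (3) $\mathrm{ad}^r_{f(i,j)}+\varphi'(ij)=\varphi'(j)\varphi'(i)+\varphi(i)\varphi'(j)$; (4) $\varphi(i)(mn)=(\varphi(i)m)n+m(\varphi(i)n)$; (5) $\varphi(i)\varphi(j)=\varphi(ij)+\varphi(j)\varphi(i)+\mathrm{ad}^l_{f(i,j)}$; (6)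 $\varphi(i)\varphi'(j)=\varphi'(j)\varphi(i)+\varphi'(ij)+\mathrm{ad}^r_{f(i,j)}$; (7) $f(i,jk)+\varphi(i)f(j,k)=f(ij,k)+\varphi'(k)f(i,j)+f(j,ik)+\varphi(j)f(i,k)$. An extension of $A$ by $B$ is a short exact sequence $0\to A\xrightarrow{\sigma}L\xrightarrow{\pi}B\to0$ with $L$ a Leibniz algebra and $\sigma,\pi$ algebra homomorphisms; it is central if $\sigma(A)\subseteq Z(L)$. A section is a linear map $T:B\to L$ with $\pi T=I_B$. For $x\in L$, $m\in A$ put $P(x)m=\sigma^{-1}(x\sigma(m))$ and $P'(x)m=\sigma^{-1}(\sigma(m)x)$. A factor system $(\varphi,\varphi',f)$ belongs to the extension and $T$ if $\varphi=PT$, $\varphi'=P'T$, and $\sigma(f(i,j))=T(i)T(j)-T(ij)$ for all $i,j\in B$. A factor system is central if it belongs to a central extension (and some section). *)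

(* Defs.v *)
From HB Require Import structures.
From mathcomp Require Import all_boot all_order all_algebra.

Set Implicit Arguments.
Unset Strict Implicit.
Unset Printing Implicit Defensive.

Import GRing.Theory.
Local Open Scope ring_scope.

(* Left Leibniz algebras, of arbitrary (possibly infinite) dimension. *)
HB.mixin Record Lmodule_isLeibniz (F : fieldType) A of GRing.Lmodule F A := {
  leibniz_mul : {bilinear A -> A -> A};
  leibniz_identity : forall x y z : A,
    leibniz_mul x (leibniz_mul y z) =
      leibniz_mul (leibniz_mul x y) z + leibniz_mul y (leibniz_mul x z)
}.

#[short(type="leibnizType")]
HB.structure Definition Leibniz (F : fieldType) :=
  {A of GRing.Lmodule F A & Lmodule_isLeibniz F A}.

Notation "x ** y" := (leibniz_mul x y) (at level 40, left associativity).

Section LeibnizAlgebra.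
Variables (F : fieldType) (A : leibnizType F).

Definition abelian_leibniz : Prop := forall x y : A, x ** y = 0.

Definition in_center (z : A) : Prop := forall x : A, z ** x = 0 /\ x ** z = 0.

Definition ad_l (m n : A) : A := m ** n.
Definition ad_r (m n : A) : A := n ** m.

Definition derivation (D : A -> A) : Prop :=
  forall m n : A, D (m ** n) = D m ** n + m ** D n.

End LeibnizAlgebra.

Section FactorSystem.
Variables (F : fieldType) (A B : leibnizType F).

(* MathComp has no vector space of linear endomorphisms of an arbitrary lmodType,
   so a linear map from B to L(A) is given in uncurried form, as a bilinear map
   B -> A -> A; that it takes values in Der(A) is fs_der.  Identities between
   operators on A are stated pointwise. *)
Record factor_system (phi phi' : {bilinear B -> A -> A})
    (f : {bilinear B -> B -> A}) : Prop := FactorSystem {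
  fs_der : forall i, derivation (phi i);
  fs1 : forall i m n, m ** phi i n = phi' i m ** n + phi i (m ** n);
  fs2 : forall i m n, m ** phi' i n = phi' i (m ** n) + n ** phi' i m;
  fs3 : forall i j m,
    ad_r (f i j) m + phi' (i ** j) m = phi' j (phi' i m) + phi i (phi' j m);
  fs4 : forall i m n, phi i (m ** n) = phi i m ** n + m ** phi i n;
  fs5 : forall i j m,
    phi i (phi j m) = phi (i ** j) m + phi j (phi i m) + ad_l (f i j) m;
  fs6 : forall i j m,
    phi i (phi' j m) = phi' j (phi i m) + phi' (i ** j) m + ad_r (f i j) m;
  fs7 : forall i j k,
    f i (j ** k) + phi i (f j k) =
      f (i ** j) k + phi' k (f i j) + f j (i ** k) + phi j (f i k)
}.

Record extension := Extension {
  ext_alg : leibnizType F;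
  ext_inj : {linear A -> ext_alg};
  ext_proj : {linear ext_alg -> B};
  ext_injM : forall m n : A, ext_inj (m ** n) = ext_inj m ** ext_inj n;
  ext_projM : forall x y : ext_alg,
    ext_proj (x ** y) = ext_proj x ** ext_proj y;
  ext_inj_injective : injective ext_inj;
  ext_proj_surjective : forall b : B, exists x, ext_proj x = b;
  ext_exact : forall x : ext_alg, (exists m, ext_inj m = x) <-> ext_proj x = 0
}.

Definition central_extension (E : extension) : Prop :=
  forall m : A, in_center (ext_inj E m).

Definition ext_section (E : extension) (T : {linear B -> ext_alg E}) : Prop :=
  forall i : B, ext_proj E (T i) = i.

Section Induced.
Variable E : extension.
Local Notation sigma := (ext_inj E).
Local Notation proj := (ext_proj E).

Lemma ext_imageP (x : ext_alg E) : proj x = 0 -> exists m, sigma m == x.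
Proof. by move=> /ext_exact[m <-]; exists m. Qed.

(* The inverse of sigma on its image, which is the kernel of proj. *)
Definition ext_inv (x : ext_alg E) (hx : proj x = 0) : A :=
  xchoose (ext_imageP hx).

Lemma ext_invK (x : ext_alg E) (hx : proj x = 0) : sigma (ext_inv hx) = x.
Proof. exact/eqP/(xchooseP (ext_imageP hx)). Qed.

Lemma ext_proj_inj (m : A) : proj (sigma m) = 0.
Proof. by apply/ext_exact; exists m. Qed.

Lemma ext_proj_mulr (x : ext_alg E) (m : A) : proj (x ** sigma m) = 0.
Proof. by rewrite ext_projM ext_proj_inj linear0r. Qed.

Lemma ext_proj_mull (x : ext_alg E) (m : A) : proj (sigma m ** x) = 0.
Proof. by rewrite ext_projM ext_proj_inj linear0l. Qed.

Definition ext_P (x : ext_alg E) (m : A) : A := ext_inv (ext_proj_mulr x m).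
Definition ext_P' (x : ext_alg E) (m : A) : A := ext_inv (ext_proj_mull x m).

End Induced.

Definition belongs (phi phi' : {bilinear B -> A -> A})
    (f : {bilinear B -> B -> A}) (E : extension)
    (T : {linear B -> ext_alg E}) : Prop :=
  [/\ forall i m, phi i m = ext_P (T i) m,
      forall i m, phi' i m = ext_P' (T i) m
    & forall i j, ext_inj E (f i j) = T i ** T j - T (i ** j)].

Definition central_factor_system (phi phi' : {bilinear B -> A -> A})
    (f : {bilinear B -> B -> A}) : Prop :=
  exists (E : extension) (T : {linear B -> ext_alg E}),
    [/\ central_extension E, ext_section T & belongs phi phi' f T].

End FactorSystem.

Arguments abelian_leibniz {F} A.

(* Main.v *)
Require Import Defs.
From HB Require Import structures.
From mathcomp Require Import all_boot all_order all_algebra.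

Set Implicit Arguments.
Unset Strict Implicit.
Unset Printing Implicit Defensive.

Import GRing.Theory.
Local Open Scope ring_scope.

(** Suppose first that the factor system belongs to a central extension, with
    inclusion sigma of A, and to a section T.  As sigma is injective, the
    vanishing of phi and phi' can be tested in the extension: phi i m and
    phi' i m are the elements of A that sigma sends to T i ** sigma m and
    sigma m ** T i, so they vanish because sigma m is central
    ([central_ext_P], [central_ext_P']).

    Conversely, once phi and phi' vanish, the last identity of a factor system
    says precisely that f is a 2-cocycle of B with coefficients in the trivial
    module A ([factor_system0_cocycle]).  This is exactly what makes A * B a
    Leibniz algebra under (m, i) ** (n, j) = (f i j, i ** j)
    ([cocycle_mul_leibniz]).  In that product the A-coordinates of the factors
    are ignored, so A sits centrally inside it, and the inclusion of A is
    multiplicative because A is abelian.  With respect to the section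
    i |-> (0, i), the factor system recovered from this extension is
    (0, 0, f). *)

Section CocycleExtension.
Variables (F : fieldType) (A B : leibnizType F).

Definition leibniz_cocycle (f : B -> B -> A) : Prop :=
  forall i j k, f i (j ** k) = f (i ** j) k + f j (i ** k).

Variables (f : {bilinear B -> B -> A}) (fC : leibniz_cocycle f).

(** An alias of the product space, so that its multiplication may depend on f;
    the cocycle proof is a parameter because the Leibniz identity needs it. *)
Definition cocycle_alg of leibniz_cocycle f : Type := (A * B)%type.

HB.instance Definition _ := GRing.Lmodule.on (cocycle_alg fC).

Definition cocycle_mul (x y : cocycle_alg fC) : cocycle_alg fC :=
  (f x.2 y.2, x.2 ** y.2).

Lemma cocycle_mul_bilinear : bilinear_for *:%R *:%R cocycle_mul.
Proof.
by split=> x a u v; rewrite /cocycle_mul /= ?linearPl ?linearPr.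
Qed.

HB.instance Definition _ :=
  bilinear_isBilinear.Build F (cocycle_alg fC) (cocycle_alg fC)
    (cocycle_alg fC) *:%R *:%R cocycle_mul cocycle_mul_bilinear.

Lemma cocycle_mul_leibniz (x y z : cocycle_alg fC) :
  cocycle_mul x (cocycle_mul y z) =
    cocycle_mul (cocycle_mul x y) z + cocycle_mul y (cocycle_mul x z).
Proof. by rewrite /cocycle_mul /= fC leibniz_identity. Qed.

HB.instance Definition _ :=
  Lmodule_isLeibniz.Build F (cocycle_alg fC) cocycle_mul_leibniz.

Definition cocycle_inj (m : A) : cocycle_alg fC := (m, 0).
Definition cocycle_proj (x : cocycle_alg fC) : B := x.2.
Definition cocycle_section (i : B) : cocycle_alg fC := (0, i).

Lemma cocycle_inj_linear : linear cocycle_inj.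
Proof. by move=> a m n; congr pair; rewrite /= scaler0 addr0. Qed.

HB.instance Definition _ :=
  GRing.isLinear.Build F A (cocycle_alg fC) *:%R cocycle_inj
    cocycle_inj_linear.

Lemma cocycle_proj_linear : linear cocycle_proj.
Proof. by []. Qed.

HB.instance Definition _ :=
  GRing.isLinear.Build F (cocycle_alg fC) B *:%R cocycle_proj
    cocycle_proj_linear.

Lemma cocycle_section_linear : linear cocycle_section.
Proof. by move=> a i j; congr pair; rewrite /= scaler0 addr0. Qed.

HB.instance Definition _ :=
  GRing.isLinear.Build F B (cocycle_alg fC) *:%R cocycle_section
    cocycle_section_linear.

Lemma cocycle_inj_central (m : A) : in_center (cocycle_inj m).
Proof.
by move=> x; split; congr pair; rewrite /= ?linear0l ?linear0r.
Qed.

Lemma cocycle_injM (hA : abelian_leibniz A) (m n : A) :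
  cocycle_inj (m ** n) = cocycle_inj m ** cocycle_inj n.
Proof. by rewrite hA linear0 (cocycle_inj_central m (cocycle_inj n)).1. Qed.

Lemma cocycle_projM (x y : cocycle_alg fC) :
  cocycle_proj (x ** y) = cocycle_proj x ** cocycle_proj y.
Proof. by []. Qed.

Lemma cocycle_inj_injective : injective cocycle_inj.
Proof. by move=> m n []. Qed.

Lemma cocycle_proj_surjective (b : B) : exists x, cocycle_proj x = b.
Proof. by exists (cocycle_section b). Qed.

Lemma cocycle_exact (x : cocycle_alg fC) :
  (exists m, cocycle_inj m = x) <-> cocycle_proj x = 0.
Proof.
split=> [[m <-] //|]; case: x => m i; rewrite /cocycle_proj /= => ->.
by exists m.
Qed.

Definition cocycle_extension (hA : abelian_leibniz A) : extension A B :=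
  Extension (cocycle_injM hA) cocycle_projM cocycle_inj_injective
    cocycle_proj_surjective cocycle_exact.

Lemma cocycle_section_mul (i j : B) :
  cocycle_inj (f i j) =
    cocycle_section i ** cocycle_section j - cocycle_section (i ** j).
Proof. by congr pair; rewrite /= ?subr0 ?subrr. Qed.

End CocycleExtension.

Section CentralExtension.
Variables (F : fieldType) (A B : leibnizType F) (E : extension A B).
Hypothesis E_central : central_extension E.

Lemma central_ext_P (x : ext_alg E) (m : A) : ext_P x m = 0.
Proof.
apply: (@ext_inj_injective _ _ _ E).
by rewrite ext_invK linear0 (E_central m x).2.
Qed.

Lemma central_ext_P' (x : ext_alg E) (m : A) : ext_P' x m = 0.
Proof.
apply: (@ext_inj_injective _ _ _ E).
by rewrite ext_invK linear0 (E_central m x).1.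
Qed.

End CentralExtension.

Lemma factor_system0_cocycle (F : fieldType) (A B : leibnizType F)
    (phi phi' : {bilinear B -> A -> A}) (f : {bilinear B -> B -> A}) :
    factor_system phi phi' f ->
    (forall i m, phi i m = 0) -> (forall i m, phi' i m = 0) ->
  leibniz_cocycle f.
Proof.
move=> hfs phi0 phi'0 i j k.
by have := fs7 hfs i j k; rewrite !phi0 phi'0 !addr0.
Qed.

Theorem theorem3p9 (F : fieldType) (A B : leibnizType F)
    (hA : abelian_leibniz A)
    (phi phi' : {bilinear B -> A -> A}) (f : {bilinear B -> B -> A})
    (hfs : factor_system phi phi' f) :
  central_factor_system phi phi' f <->
    (forall (i : B) (m : A), phi i m = 0) /\
    (forall (i : B) (m : A), phi' i m = 0).
Proof.
split=> [[E [T [Ec _ [phiE phi'E _]]]]|[phi0 phi'0]].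
  by split=> i m; rewrite (phiE, phi'E) (central_ext_P, central_ext_P').
have fC := factor_system0_cocycle hfs phi0 phi'0.
have Ec : central_extension (cocycle_extension fC hA).
  exact: cocycle_inj_central.
exists (cocycle_extension fC hA), (cocycle_section fC).
split=> //; split=> [i m|i m|i j].
- by rewrite phi0 central_ext_P.
- by rewrite phi'0 central_ext_P'.
exact: cocycle_section_mul.
Qed.
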